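(* Let $F$ be a field of characteristic $p\neq 0$, let $n\ge 1$, and let $PS_n$ be the symplectic Poisson algebra over $F$, i.e. the polynomial algebra $F[x_1,\ldots,x_n;y_1,\ldots,y_n]$ with the Poisson bracket determined by $\{x_i,y_j\}=\delta_{ij}$, $\{x_i,x_j\}=0$, $\{y_i,y_j\}=0$. Then every homomorphism of Poisson algebras $\varphi: PS_n\to PS_n$ over $F$ is injective.
   Context: A Poisson algebra over $F$ is an $F$-vector space $B$ with two bilinear operations, a multiplication $x\cdot y$ and a Poisson bracket $\{x,y\}$, such that $B$ is a commutative associative algebra under $\cdot$, a Lie algebra under $\{\,,\}$, and $\{x,y\cdot z\}=\{x,y\}\cdot z+y\cdot\{x,z\}$. In $PS_n$ the bracket is explicitly $$\{f,g\}=\sum_{i=1}^n\left(\frac{\partial f}{\partial x_i}\frac{\partial g}{\partial y_i}-\frac{\partial f}{\partial y_i}\frac{\partial g}{\partial x_i}\right),$$ and $\delta_{ij}$ is the Kronecker symbol. A homomorphism of Poisson algebras over $F$ is a unital $F$-algebra homomorphism $\varphi$ with $\varphi(\{f,g\})=\{\varphi(f),\varphi(g)\}$ for all $f,g$. *)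

(* Defs.v *)
From HB Require Import structures.
From mathcomp Require Import all_boot all_order all_algebra.
From mathcomp Require Export mpoly.
From mathcomp Require Import ring.

Set Implicit Arguments.
Unset Strict Implicit.
Unset Printing Implicit Defensive.

Import GRing.Theory.
Local Open Scope ring_scope.

(* The associative commutative multiplication is that of the algebra [B].  The
   Lie bracket is required to be alternating, which is stronger than
   antisymmetric in characteristic 2. *)
Record is_poisson_bracket (F : fieldType) (B : comAlgType F)
    (br : B -> B -> B) : Prop := IsPoissonBracket {
  poisson_linearl : forall g, linear (br^~ g);
  poisson_linearr : forall f, linear (br f);
  poisson_alternating : forall f, br f f = 0;
  poisson_jacobi : forall f g h,
    br f (br g h) + br g (br h f) + br h (br f g) = 0;
  poisson_leibniz : forall f g h, br f (g * h) = br f g * h + g * br f h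
}.

Definition poisson_hom (F : fieldType) (B C : comAlgType F)
    (brB : B -> B -> B) (brC : C -> C -> C) (phi : {lrmorphism B -> C}) : Prop :=
  forall f g, phi (brB f g) = brC (phi f) (phi g).

(* Polynomials in x_1, ..., x_n (indices [lshift n i]) and y_1, ..., y_n
   (indices [rshift n i]). *)
Notation PS F n := {mpoly F[n + n]}.

Section SymplecticPoissonAlgebra.
Variables (F : fieldType) (n : nat).
Implicit Types (f g h : PS F n) (i j : 'I_n).

Definition PSx i : PS F n := 'X_(lshift n i).
Definition PSy i : PS F n := 'X_(rshift n i).

Definition PSbr f g : PS F n :=
  \sum_(i < n) (mderiv (lshift n i) f * mderiv (rshift n i) g
                - mderiv (rshift n i) f * mderiv (lshift n i) g).

Let mderiv_var (k l : 'I_(n + n)) :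
  mderiv k ('X_l : {mpoly F[n + n]}) = (l == k)%:R.
Proof.
rewrite mderivX mnmE; case: (l =P k) => [->|_] /=; last by rewrite scale0r.
by rewrite scale1r (_ : (_ - _)%MM = 0%MM) ?mpolyX0 //; apply/mnmP => ?; rewrite mnmBE subnn mnm0E.
Qed.

Let PSvarE := (mderiv_var, eq_lshift, eq_rshift, eq_lrshift, eq_rlshift).

Lemma PSbr_xy i j : PSbr (PSx i) (PSy j) = (i == j)%:R.
Proof.
rewrite /PSbr (bigD1 i) //= big1 => [|k /negPf ki].
  by rewrite !PSvarE eqxx mul1r mul0r subr0 addr0 eq_sym.
by rewrite !PSvarE eq_sym ki !mul0r subr0.
Qed.

Lemma PSbr_xx i j : PSbr (PSx i) (PSx j) = 0.
Proof. by rewrite /PSbr big1 // => k _; rewrite !PSvarE mulr0 mul0r subr0. Qed.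

Lemma PSbr_yy i j : PSbr (PSy i) (PSy j) = 0.
Proof. by rewrite /PSbr big1 // => k _; rewrite !PSvarE mulr0 mul0r subr0. Qed.

Let A f g h i j : PS F n :=
  let D k := mderiv (lshift n k) in let E k := mderiv (rshift n k) in
  D i f * (E i (D j g) * E j h - E i (E j g) * D j h)
  - E i f * (D i (D j g) * E j h - D i (E j g) * D j h).

Let PSbrA f g h : PSbr f (PSbr g h) =
  \sum_(i < n) \sum_(j < n) A f g h i j - \sum_(i < n) \sum_(j < n) A g h f i j.
Proof.
rewrite [X in _ - X]exchange_big /= -sumrB; apply: eq_bigr => i _.
rewrite -sumrB !raddf_sum /= !mulr_sumr -sumrB; apply: eq_bigr => j _.
rewrite /A !mderivB !mderivM.
rewrite (mderiv_comm (lshift n i) (lshift n j) h).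
rewrite (mderiv_comm (lshift n i) (rshift n j) h).
rewrite (mderiv_comm (rshift n i) (lshift n j) h).
rewrite (mderiv_comm (rshift n i) (rshift n j) h).
ring.
Qed.

Lemma PSbr_is_poisson : is_poisson_bracket PSbr.
Proof.
split.
- move=> g a f1 f2; rewrite /PSbr scaler_sumr -big_split; apply: eq_bigr => i _.
  by rewrite !linearP /= -!mul_mpolyC; ring.
- move=> f a g1 g2; rewrite /PSbr scaler_sumr -big_split; apply: eq_bigr => i _.
  by rewrite !linearP /= -!mul_mpolyC; ring.
- by move=> f; rewrite /PSbr big1 // => i _; rewrite mulrC subrr.
- by move=> f g h; rewrite !PSbrA; ring.
- move=> f g h; rewrite /PSbr mulr_suml mulr_sumr -big_split.
  by apply: eq_bigr => i _; rewrite !mderivM /=; ring.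
Qed.

End SymplecticPoissonAlgebra.

(* Main.v *)
Require Import Defs.
From HB Require Import structures.
From mathcomp Require Import all_boot all_order all_algebra.
From mathcomp Require Import mpoly.

Set Implicit Arguments.
Unset Strict Implicit.
Unset Printing Implicit Defensive.

Import GRing.Theory.
Local Open Scope ring_scope.

(** A Poisson endomorphism is injective because it is formally invertible at
    the origin.  Let [u_k] be the images of the variables, [c_k] the constant
    term of [u_k] and [L] the matrix of the linear parts of the [u_k].  The
    brackets [{u_i, u_j}] are the images of the constants [{z_i, z_j}], hence
    are these same constants; reading off constant terms turns this into
    [L *m S *m L^T = S], where [S] is the matrix of the standard symplectic
    form, so [L] is invertible ([PSbr_hom_linear_part_unit]).

    An endomorphism of a polynomial algebra over a field is injective as soon
    as its linear part at the origin is invertible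
    ([linear_part_unit_inj]).  Indeed an affine change of variables
    reduces this to the case where [u_k] is [z_k] plus terms of degree at least
    2.  Such an endomorphism keeps the homogeneous component of lowest degree
    of every polynomial, so it kills none but 0 ([tangent_to_id_inj]). *)

(** * Lowest-degree terms *)

Section Order.
Variables (F : fieldType) (n : nat).
Implicit Types (f g : {mpoly F[n]}) (m : 'X_{1..n}).

Definition ord_ge d f := forall m, (mdeg m < d)%N -> f@_m = 0.

Lemma ord_geW d e f : (d <= e)%N -> ord_ge e f -> ord_ge d f.
Proof. by move=> le_de fe m m_d; apply/fe/(leq_trans m_d). Qed.

Lemma ord_geD d f g : ord_ge d f -> ord_ge d g -> ord_ge d (f + g).
Proof. by move=> fd gd m m_d; rewrite mcoeffD fd // gd // addr0. Qed.

Lemma ord_geN d f : ord_ge d f -> ord_ge d (- f).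
Proof. by move=> fd m m_d; rewrite mcoeffN fd // oppr0. Qed.

Lemma ord_geZ d a f : ord_ge d f -> ord_ge d (a *: f).
Proof. by move=> fd m m_d; rewrite mcoeffZ fd // mulr0. Qed.

Lemma ord_geM d e f g : ord_ge d f -> ord_ge e g -> ord_ge (d + e) (f * g).
Proof.
move=> fd ge m m_de; rewrite mcoeffM big1 // => k /eqP def_m.
have [k1_d|d_k1] := ltnP (mdeg k.1) d; first by rewrite fd ?mul0r.
rewrite (ge k.2) ?mulr0 //.
move/(congr1 mdeg): def_m; rewrite mdegD => deg_m.
rewrite -(ltn_add2l d); apply: leq_ltn_trans m_de.
by rewrite [leqRHS]deg_m leq_add2r.
Qed.

Lemma ord_geX m : ord_ge (mdeg m) ('X_[m]).
Proof. by move=> k; rewrite mcoeffX; case: eqP => // ->; rewrite ltnn. Qed.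

Lemma ord_ge_eq0 f : (forall d, ord_ge d f) -> f = 0.
Proof.
by move=> f_oo; apply/mpolyP => m; rewrite mcoeff0 (f_oo (mdeg m).+1).
Qed.

(** Congruence of two polynomials of order at least [d] modulo terms of higher
    degree, i.e. equality of their components of degree [d]. *)
Definition same_init d f g := ord_ge d g /\ ord_ge d.+1 (f - g).

Lemma same_init1 : same_init 0 1 1.
Proof. by split=> [m | m _]; rewrite ?subrr ?mcoeff0. Qed.

Lemma same_initM d e f g f' g' :
  same_init d f g -> same_init e f' g' -> same_init (d + e) (f * f') (g * g').
Proof.
move=> [gd fg] [ge fg']; split; first exact: ord_geM.
have f'e: ord_ge e f' by rewrite -(subrK g' f'); apply: ord_geD (ord_geW _ fg') _.
have ->: f * f' - g * g' = (f - g) * f' + g * (f' - g').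
  by rewrite mulrBl mulrBr addrA subrK.
by apply: ord_geD; [rewrite -addSn | rewrite -addnS]; apply: ord_geM.
Qed.

End Order.

(** * Endomorphisms with invertible linear part *)

Section LinearPart.
Variables (F : fieldType) (n : nat).
Implicit Types (phi psi : {lrmorphism {mpoly F[n]} -> {mpoly F[n]}}).

Lemma mpoly_lrmorphism_ext phi psi :
  (forall k, phi 'X_k = psi 'X_k) -> phi =1 psi.
Proof.
move=> eqX f; rewrite [f]mpolyE !linear_sum; apply: eq_bigr => m _.
rewrite !linearZ mpolyXE_id !rmorph_prod; congr (_ *: _).
by apply: eq_bigr => k _; rewrite !rmorphXn /= eqX.
Qed.

(** The lowest homogeneous component of [f] is fixed by [phi]: the
    congruence holds for monomials by multiplicativity, and for [f] because all
    its monomials have degree at least [d]. *)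
Lemma tangent_to_id_same_init phi :
    (forall k, same_init 1 (phi 'X_k) 'X_k) ->
  forall d f, ord_ge d f -> ord_ge d.+1 (phi f - f).
Proof.
move=> phi1 d f fd.
have phiX m : same_init (mdeg m) (phi 'X_[m]) 'X_[m].
  rewrite mpolyXE_id mdegE rmorph_prod.
  apply: (big_rec3 (fun x d y => same_init d x y)) => [|k p e q _ pq].
    exact: same_init1.
  apply: same_initM => //; rewrite rmorphXn.
  elim: (m k) => [|j IHj]; first exact: same_init1.
  by rewrite !exprS -add1n; apply: same_initM => //; apply: phi1.
have ->: phi f - f = \sum_(m <- msupp f) f@_m *: (phi 'X_[m] - 'X_[m]).
  rewrite {1 2}[f]mpolyE linear_sum -sumrB.
  by apply: eq_bigr => m _; rewrite linearZ scalerBr.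
rewrite big_seq; apply: big_ind => [m _|? ? | m].
- by rewrite mcoeff0.
- exact: ord_geD.
- rewrite mcoeff_msupp => fm; apply: ord_geZ; apply: ord_geW (proj2 (phiX m)).
  by rewrite ltnS leqNgt; apply: contra fm => /fd->.
Qed.

(** An element of the kernel has order at least [d] for every [d], by induction
    on [d]. *)
Lemma tangent_to_id_inj phi :
  (forall k, same_init 1 (phi 'X_k) 'X_k) -> injective phi.
Proof.
move=> phi1; apply: raddf_inj => f phif0; apply: ord_ge_eq0.
elim=> [//|d /(tangent_to_id_same_init phi1)].
by rewrite phif0 sub0r => /ord_geN; rewrite opprK.
Qed.

Definition linear_part phi : 'M[F]_n := \matrix_(k, l) (phi 'X_k)@_U_(l).

Definition affine_sub (A : 'M[F]_n) (b : 'cV[F]_n) :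
    {lrmorphism {mpoly F[n]} -> {mpoly F[n]}} :=
  comp_mpoly [tuple (b k 0)%:MP + \sum_l A k l *: 'X_l | k < n].

Lemma affine_subX A b k :
  affine_sub A b 'X_k = (b k 0)%:MP + \sum_l A k l *: 'X_l.
Proof. by rewrite /= comp_mpolyXU -tnth_nth tnth_mktuple. Qed.

Lemma lrmorphism_affine_subX phi A b k :
  phi (affine_sub A b 'X_k) = (b k 0)%:MP + \sum_l A k l *: phi 'X_l.
Proof.
rewrite affine_subX linearD linear_sum -[(b k 0)%:MP]alg_mpolyC linearZ rmorph1.
by congr (_ + _); apply: eq_bigr => l _; rewrite linearZ.
Qed.

(** The two conditions say that the affine maps with linear parts [A], [B] and
    constant terms [b], [d] compose to the identity. *)
Lemma affine_subK A b B d :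
    A *m B = 1%:M -> b + A *m d = 0 ->
  cancel (affine_sub A b) (affine_sub B d).
Proof.
move=> AB bAd.
apply: (@mpoly_lrmorphism_ext (affine_sub B d \o affine_sub A b) idfun) => k.
rewrite -[LHS]/(affine_sub B d (affine_sub A b 'X_k)) -[RHS]/'X_k.
rewrite lrmorphism_affine_subX.
under eq_bigr do rewrite affine_subX scalerDr.
rewrite big_split addrA /=.
have -> : \sum_l A k l *: (d l 0)%:MP = ((A *m d) k 0)%:MP :> {mpoly F[n]}.
  by rewrite mxE rmorph_sum; apply: eq_bigr => l _; rewrite /= mpolyCM mul_mpolyC.
have -> : \sum_l A k l *: \sum_j B l j *: 'X_j
    = \sum_j (A *m B) k j *: 'X_j :> {mpoly F[n]}.
  under eq_bigr do rewrite scaler_sumr.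
  rewrite exchange_big; apply: eq_bigr => j _; rewrite mxE scaler_suml.
  by apply: eq_bigr => l _; rewrite scalerA.
have bAdk: b k 0 + (A *m d) k 0 = 0.
  by move/matrixP/(_ k 0): bAd; rewrite mxE [RHS]mxE.
rewrite -mpolyCD bAdk mpolyC0 add0r AB.
rewrite (bigD1 k) //= big1 ?addr0 ?mxE ?eqxx ?scale1r // => l.
by rewrite eq_sym mxE => /negPf->; rewrite scale0r.
Qed.

Lemma linear_part_unit_inj phi : linear_part phi \in unitmx -> injective phi.
Proof.
move=> uL; pose L := linear_part phi.
pose c : 'cV_n := \col_k (phi 'X_k)@_0%MM.
pose d : 'cV_n := - (invmx L *m c).
(* [affine_sub L c] truncates the [phi 'X_k] in degree 1. *)
have subK: cancel (affine_sub L c) (affine_sub (invmx L) d).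
  by apply: affine_subK; rewrite ?mulmxN ?mulmxA mulmxV // mul1mx subrr.
have invK: cancel (affine_sub (invmx L) d) (affine_sub L c).
  by apply: affine_subK; rewrite ?mulVmx // addNr.
(* It remains to see that undoing this truncation makes [phi] tangent to the
   identity. *)
suff inj: injective (phi \o affine_sub (invmx L) d).
  move=> f g eq_fg; rewrite -[f]subK -[g]subK; congr (affine_sub _ _ _).
  by apply: inj; rewrite /comp !subK.
apply: (@tangent_to_id_inj (phi \o affine_sub (invmx L) d)) => k.
split=> [|m]; first by rewrite -(mdeg1 k); apply: ord_geX.
rewrite -[X in X - _]/(phi (affine_sub (invmx L) d 'X_k)) -[X in _ - X]invK.
rewrite !lrmorphism_affine_subX opprD addrACA subrr add0r.
rewrite -sumrB raddf_sum /= => m_le1; rewrite big1 // => l _.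
(* [phi 'X_l] and its truncation have the same coefficients in degree at
   most 1. *)
rewrite -scalerBr mcoeffZ affine_subX mcoeffB mcoeffD mcoeffC raddf_sum /=.
move: m_le1; rewrite ltnS leq_eqVlt ltnS leqn0 => /orP[/mdeg1P[j /eqP->]|].
  rewrite (bigD1 j) //= big1 => [|i ij]; last first.
    by rewrite mcoeffZ mcoeffXU (negPf ij) mulr0.
  rewrite mcoeffZ mcoeffXU eqxx mnm1_eq0 mulr0 add0r addr0 mulr1 mxE subrr.
  by rewrite mulr0.
rewrite mdeg_eq0 => /eqP->; rewrite eqxx mulr1 big1 => [|i _]; last first.
  by rewrite mcoeffZ mcoeffX mnm1_eq0 mulr0.
by rewrite mxE addr0 subrr mulr0.
Qed.

End LinearPart.

(** * Poisson brackets and linear parts *)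

Section Symplectic.
Variables (F : fieldType) (n : nat).
Implicit Types (phi : {lrmorphism PS F n -> PS F n}).

Definition symp_mx : 'M[F]_(n + n) := block_mx 0 1%:M (- 1%:M) 0.

Lemma symp_mx_orthogonal : symp_mx *m symp_mx^T = 1%:M.
Proof.
rewrite tr_block_mx mulmx_block !trmx0 linearN /= !trmx1.
by rewrite !mulmx0 !mul0mx !mulmxN !mulNmx !mulmx1 opprK !addr0 add0r -scalar_mx_block.
Qed.

(** The constant term of a first derivative is a linear coefficient, so the
    constant term of a bracket is the symplectic form of the linear parts. *)
Lemma PSbr_const_term phi i j :
  (PSbr (phi 'X_i) (phi 'X_j))@_0%MM
    = (linear_part phi *m symp_mx *m (linear_part phi)^T) i j.
Proof.
set L := linear_part phi; rewrite -[L]hsubmxK tr_row_mx mul_row_block.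
rewrite !mulmx0 mulmxN !mulmx1 add0r addr0 mul_row_col mulNmx addrC.
rewrite !mxE raddf_sum /= -sumrB; apply: eq_bigr => k _.
by rewrite mcoeffB !rmorphM /= !mcoeff_deriv !mnmE !mulr1n !add0m !mxE.
Qed.

Lemma linear_part_id : linear_part (idfun : {lrmorphism PS F n -> PS F n}) = 1%:M.
Proof. by apply/matrixP => k l; rewrite !mxE mcoeffXU. Qed.

(** The brackets of the variables are integers, which every [phi] fixes. *)
Lemma lrmorphism_PSbr_var phi i j : phi (PSbr 'X_i 'X_j) = PSbr 'X_i 'X_j.
Proof.
have mderiv_var (k l : 'I_(n + n)) : mderiv k ('X_l : PS F n) = (l == k)%:R.
  rewrite mderivX mnm1E; case: (l =P k) => [->|_]; last by rewrite scale0r.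
  by rewrite scale1r -[X in (X - _)%MM]add0m addmK mpolyX0.
rewrite /PSbr rmorph_sum; apply: eq_bigr => k _.
by rewrite !mderiv_var rmorphB !rmorphM !rmorph_nat.
Qed.

(** The linear part is a symplectic matrix, whence invertible. *)
Lemma PSbr_hom_linear_part_unit phi :
  poisson_hom (@PSbr F n) (@PSbr F n) phi -> linear_part phi \in unitmx.
Proof.
move=> phi_hom; set L := linear_part phi.
have LSL: L *m symp_mx *m L^T = symp_mx.
  apply/matrixP => i j; rewrite -PSbr_const_term -phi_hom lrmorphism_PSbr_var.
  by rewrite [LHS](PSbr_const_term idfun) linear_part_id trmx1 mul1mx mulmx1.
have: L *m (symp_mx *m L^T *m symp_mx^T) = 1%:M.
  by rewrite !mulmxA LSL symp_mx_orthogonal.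
by case/mulmx1_unit.
Qed.

End Symplectic.

Theorem theorem1 (F : fieldType) (p : nat) (charF : p \in [pchar F])
    (n : nat) (n_ge1 : (1 <= n)%N)
    (phi : {lrmorphism PS F n -> PS F n})
    (phi_hom : poisson_hom (@PSbr F n) (@PSbr F n) phi) :
  injective phi.
Proof. exact/linear_part_unit_inj/PSbr_hom_linear_part_unit. Qed.
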